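(* Let $\ell,m$ and $n$ be positive integers with $m$ dividing $\ell$, and let $W=G(\ell,m,n)$ be the group of $n$ by $n$ complex matrices with entries that are either $0$ or $\ell$th roots of $1$, such that each row and each column has precisely one non-zero entry, and such that the product of the non-zero entries is an $(\ell/m)$th root of $1$. Assume that $W$ acts irreducibly on $\mathfrak{h}=\mathbf{C}^n$. Then $$\dim_{\mathbf{C}}(R_W)\ge(\ell(n-1)+2\ell/m-1)^n.$$
   Context: $W$ acts on $\mathfrak{h}=\mathbf{C}^n$ by matrix multiplication and hence by automorphisms on the ring $\mathbf{C}[\mathfrak{h}^*\oplus\mathfrak{h}]$ of polynomial functions on $\mathfrak{h}^*\oplus\mathfrak{h}$ (diagonal action). Let $I_W$ be the ideal of $\mathbf{C}[\mathfrak{h}^*\oplus\mathfrak{h}]$ generated by the positive-degree elements of the invariant ring $\mathbf{C}[\mathfrak{h}^*\oplus\mathfrak{h}]^W$. The diagonal coinvariant ring is $R_W=\mathbf{C}[\mathfrak{h}^*\oplus\mathfrak{h}]/I_W$. *)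

(* Defs.v *)
From HB Require Import structures.
From mathcomp Require Import all_boot all_order all_algebra.
From mathcomp Require Import complex.
From mathcomp Require Import mpoly.
From mathcomp Require Import boolp classical_sets cardinality reals.

Set Implicit Arguments.
Unset Strict Implicit.
Unset Printing Implicit Defensive.

Import GRing.Theory.
Local Open Scope ring_scope.
Local Open Scope quotient_scope.

(* Possibly infinite bases of a vector space; [dim_ge V d] says that the
   cardinal dim V is at least d, infinite dimension included.  *)

Section Dimension.
Context {K : fieldType} (V : lmodType K).

Definition lin_indep (B : set V) : Prop :=
  forall (s : seq V) (a : V -> K), uniq s -> (forall v, v \in s -> B v) ->
    \sum_(v <- s) a v *: v = 0 -> forall v, v \in s -> a v = 0.

Definition spanning (B : set V) : Prop :=
  forall u : V, exists (s : seq V) (a : V -> K),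
    (forall v, v \in s -> B v) /\ u = \sum_(v <- s) a v *: v.

Definition is_basis (B : set V) : Prop := lin_indep B /\ spanning B.

Definition dim_ge (d : nat) : Prop :=
  exists B : set V, is_basis B /\ ([set: 'I_d] #<= B)%card.

End Dimension.

Definition ideal_gen (A : comNzRingType) (S : set A) : {pred A} :=
  fun f => `[< exists s : seq (A * A),
    (forall p, p \in s -> S p.2) /\ f = \sum_(p <- s) p.1 * p.2 >].

Section ComplexMatrixGroups.
Variables (R : realType) (n : nat).
Local Notation C := R[i].

Definition irreducible_on (W : {pred 'M[C]_n}) : Prop :=
  fullv != 0%VS :> {vspace 'cV[C]_n} /\
  forall U : {vspace 'cV[C]_n},
    (forall w v, w \in W -> v \in U -> w *m v \in U) -> U = 0%VS \/ U = fullv.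

(* Elements of h are column vectors v, with w acting by v |-> w v; elements of
   h^* are row vectors xi, with w acting by xi |-> xi w^-1.  The variable of
   index [lshift n i] is the i-th coordinate on h^*, the variable of index
   [rshift n i] is the i-th coordinate on h.  *)
Local Notation polyfun := {mpoly C[n + n]}.

Definition point (xi : 'rV[C]_n) (v : 'cV[C]_n) : 'I_(n + n) -> C :=
  fun k => row_mx xi v^T 0 k.

Definition diag_act (w : 'M[C]_n) (f : polyfun) : polyfun :=
  f \mPo [tuple match split k with
                | inl i => \sum_(j < n) w j i *: 'X_(lshift n j)
                | inr i => \sum_(j < n) invmx w i j *: 'X_(rshift n j)
                end | k < n + n].

Lemma diag_actE w f xi v :
  (diag_act w f).@[point xi v] = f.@[point (xi *m w) (invmx w *m v)].
Proof.
rewrite comp_mpoly_meval; apply: meval_eq => k.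
rewrite tnth_mktuple /point mxE; case: (split k) => i; rewrite raddf_sum /= !mxE;
  apply: eq_bigr => j _; rewrite mevalZ mevalXU ?row_mxEl ?row_mxEr ?mxE //.
by rewrite mulrC.
Qed.

Definition diag_invariant (W : {pred 'M[C]_n}) (f : polyfun) : Prop :=
  forall w, w \in W -> diag_act w f = f.

(* I_W: "positive-degree elements" are meant in the graded sense, as the
   homogeneous elements of degree d > 0.  *)
Definition coinv_ideal (W : {pred 'M[C]_n}) : {pred polyfun} :=
  ideal_gen [set f | diag_invariant W f /\ exists2 d, (0 < d)%N & f \is d.-homog].

Lemma coinv_idealP (W : {pred 'M[C]_n}) : idealr_closed (coinv_ideal W).
Proof.
split.
- apply/asboolP; exists [::]; split=> //; by rewrite big_nil.
- apply/asboolP => -[s [Hs /(congr1 (meval (fun=> 0)))]].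
  rewrite raddf_sum /= meval1 big_seq big1 => [/eqP|p ps]; first by rewrite oner_eq0.
  rewrite mevalM; have [_ [d d0 hd]] := Hs p ps.
  suff -> : p.2.@[fun=> 0] = 0 by rewrite mulr0.
  rewrite mevalE big_seq big1 // => m mp.
  have /eqP mdeg_m : mdeg m == d by move/dhomogP: hd => /(_ m mp)/= ->.
  suff [i mi] : exists i, m i != 0%N.
    by rewrite (bigD1 i) //= expr0n (negbTE mi) mul0r mulr0.
  apply/existsP; apply: contraTT d0; rewrite negb_exists => /forallP m0.
  rewrite -mdeg_m mdegE big1 // => i _.
  by apply/eqP; rewrite -[_ == _]negbK; exact: m0.
- move=> a f g /asboolP[s [Hs ->]] /asboolP[t [Ht ->]]; apply/asboolP.
  exists ([seq (a * p.1, p.2) | p <- s] ++ t); split.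
    by move=> p; rewrite mem_cat => /orP[/mapP[q qs ->]|]; [exact: (Hs q qs)|exact: Ht].
  rewrite big_cat big_map /= mulr_sumr; congr (_ + _).
  by apply: eq_bigr => p _; rewrite mulrA.
Qed.

HB.instance Definition _ (W : {pred 'M[C]_n}) :=
  isIdealr.Build polyfun (coinv_ideal W) (coinv_idealP W).

Definition diag_coinv (W : {pred 'M[C]_n}) := {ideal_quot (coinv_ideal W)}.

Section Algebra.
Variable W : {pred 'M[C]_n}.
Local Notation Q := (diag_coinv W).

HB.instance Definition _ := GRing.ComNzRing.on Q.

Definition coinv_scale (a : C) (x : Q) : Q := \pi_Q (a%:MP : polyfun) * x.

Lemma coinv_scaleA a b x :
  coinv_scale a (coinv_scale b x) = coinv_scale (a * b) x.
Proof. by rewrite /coinv_scale mulrA -rmorphM -mpolyCM. Qed.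

Lemma coinv_scale1 : left_id 1 coinv_scale.
Proof. by move=> x; rewrite /coinv_scale mpolyC1 rmorph1 mul1r. Qed.

Lemma coinv_scaleDr : right_distributive coinv_scale +%R.
Proof. by move=> a x y; rewrite /coinv_scale mulrDr. Qed.

Lemma coinv_scaleDl x : {morph coinv_scale^~ x : a b / a + b}.
Proof. by move=> a b; rewrite /coinv_scale mpolyCD rmorphD mulrDl. Qed.

HB.instance Definition _ := GRing.Zmodule_isLmodule.Build C Q
  coinv_scaleA coinv_scale1 coinv_scaleDr coinv_scaleDl.

Lemma coinv_scaleE (a : C) (f : polyfun) : \pi_Q (a *: f) = a *: (\pi_Q f : Q).
Proof. by rewrite -mul_mpolyC rmorphM. Qed.

End Algebra.

(* G(l,m,n), for m dividing l.  *)
Definition Glmn (l m : nat) : {pred 'M[C]_n} := [pred A : 'M[C]_n |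
  [&& [forall i, forall j, (A i j == 0) || (A i j ^+ l == 1)],
      [forall i, #|[pred j | A i j != 0]| == 1%N],
      [forall j, #|[pred i | A i j != 0]| == 1%N] &
      (\prod_(p : 'I_n * 'I_n | A p.1 p.2 != 0) A p.1 p.2) ^+ (l %/ m) == 1]].

End ComplexMatrixGroups.

Arguments Glmn {R} n l m.

(* Main.v *)
From HB Require Import structures.
Require Import Defs.
From mathcomp Require Import all_boot all_order all_algebra.
From mathcomp Require Import complex.
From mathcomp Require Import mpoly.
From mathcomp Require Import boolp classical_sets cardinality reals.
From mathcomp Require Import fingroup perm cyclic separable cyclotomic ring zify.

Set Implicit Arguments.
Unset Strict Implicit.
Unset Printing Implicit Defensive.

Import GRing.Theory Num.Theory.
Local Open Scope ring_scope.

(** Put q = l/m and d = l(n-1) + 2q - 1.  The coinvariant ring surjects onto the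
    associated graded space of a filtered vector space of dimension d^n, namely
    a module over a noncommutative deformation of the polynomial ring.

    Let M have basis e_0, ..., e_{d-1}, with a raising operator X e_a = e_{a+1}
    (and X e_{d-1} = 0) and a lowering operator Y e_a = c(a) e_{a-1}, where
    c(a) = a, except that c(a) = a - d when a = d modulo l.
    As d is not 0 modulo l, one has c(0) = c(d) = 0 and c(a) <> 0 in between, so
    that the words Y^s X^t span all of End(M); and c(a + l) - c(a) is constant,
    so that the commutator of X with Y is a scalar on each span of the e_a with
    a in a fixed class modulo l.  Let L be the n-th tensor power of M, on which
    the 2n variables act through the X_i (coordinates on h) and the Y_i
    (coordinates on h^* ): this is the simple quotient of a polynomial
    representation of a rational Cherednik algebra of G(l,1,n) in which the
    parameter of the transpositions is 0.

    Let v in L be the antisymmetrization of e_{q-1} (x) e_{q-1+l} (x) ... (x)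
    e_{q-1+l(n-1)}.  A monomial y^alpha x^beta acts on v as the normally ordered
    operator Y^alpha X^beta; the result has determinants as coordinates
    ([slater]).  Filter L by the degree of the monomials applied to v.
    - Normal ordering is multiplicative up to lower order ([var_op_filt]).
    - A polynomial h invariant under G(l,m,n) sends v to an antisymmetric vector
      supported on the e_b with all b_i congruent modulo l and to -1 modulo q.
      The bound b_i < d was chosen exactly so that q-1, q-1+l, ..., q-1+l(n-1)
      is the only set of n distinct such exponents ([exponents_perm]), hence h
      acts on v as a scalar.  When h is homogeneous of positive degree, this
      means that its value on v has lower order than expected
      ([drops_order_Glmn_support]).
    - The polynomials all of whose homogeneous components drop in order form an
      ideal ([drops_order_mull]), which therefore contains I_W.
    - All of L is reached from v ([filt_slater_full]).
    Choosing, degree by degree, monomials whose values on v form a basis adapted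
    to the filtration gives d^n monomials that are linearly independent modulo
    I_W ([adapted_monomials]).  A maximal independent set containing them is the
    required basis.

    Irreducibility of W excludes l = 1 with n > 1, the symmetric group acting on
    C^n, where d = n is 0 modulo l; for l = n = 1 the module M is a line. *)

(** * Extending independent families to bases *)

Section BasisExtension.
Context {K : fieldType} (V : lmodType K).
Implicit Types (B C : set V).

Lemma lin_indep_add B u : lin_indep B ->
  (forall (s : seq V) (a : V -> K), (forall v, v \in s -> B v) ->
     u <> \sum_(v <- s) a v *: v) ->
  lin_indep (B `|` [set u])%classic.
Proof.
move=> indB uNB s a us sB s0.
have [us'|uNs] := boolP (u \in s); last first.
  apply: indB => // v vs; case: (sB v vs) => // vu.
  by move: uNs; rewrite -[u]vu vs.
have remB v : v \in rem u s -> B v.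
  rewrite mem_rem_uniq // inE => /andP[vu vs].
  by case: (sB v vs) => // vu'; move: vu; rewrite vu' eqxx.
move: s0; rewrite (perm_big _ (perm_to_rem us')) big_cons /= => s0.
have [au0|au0] := eqVneq (a u) 0.
  move: s0; rewrite au0 scale0r add0r => s0 v vs.
  have [->//|vu] := eqVneq v u.
  by apply: (indB _ a (rem_uniq u us) remB s0); rewrite mem_rem_uniq // inE vu.
case: (uNB (rem u s) (fun v => - (a u)^-1 * a v) remB).
rewrite [RHS](_ : _ = - (a u)^-1 *: \sum_(v <- rem u s) a v *: v); last first.
  by rewrite scaler_sumr; apply: eq_bigr => v _; rewrite scalerA.
move/eqP: s0; rewrite addr_eq0 => /eqP/(canRL (scalerK au0)) {1}->.
by rewrite scaleNr scalerN.
Qed.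

(** Finiteness of the supports of linear relations enters here: it makes a union
    of a chain of independent sets independent. *)
Lemma chain_absorbs_seq B (F : set (set V)) (s : seq V) : total_on F subset ->
  (forall v, v \in s -> (B `|` \bigcup_(X in F) X)%classic v) ->
  exists X, (F X \/ X = set0) /\ forall v, v \in s -> (B `|` X)%classic v.
Proof.
move=> Fch; elim: s => [|u s IH] sF; first by exists set0; split; [right|].
have [|X [FX sX]] := IH; first by move=> v vs; apply: sF; rewrite inE vs orbT.
have [Bu|[Y FY Yu]] := sF u (mem_head _ _).
  exists X; split=> // v; rewrite inE => /predU1P[->|/sX//]; by left.
have [XY|YX] : (X `<=` Y \/ Y `<=` X)%classic.
- by case: FX => [FX|->]; [exact: Fch|left].
- exists Y; split; first by left.
  move=> v; rewrite inE => /predU1P[->|/sX[Bv|/XY]]; by [right|left|right].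
- exists X; split=> // v; rewrite inE => /predU1P[->|/sX//]; right; exact: YX.
Qed.

Lemma lin_indep_basis B : lin_indep B ->
  exists C, is_basis C /\ (B `<=` C)%classic.
Proof.
move=> indB.
have [F Find Fch|A [indA maxA]] := @Zorn_bigcup V (fun X => lin_indep (B `|` X)%classic).
  move=> s a us sF; have [X [FX sX]] := chain_absorbs_seq Fch sF.
  apply: (_ : lin_indep (B `|` X)%classic) => //.
  by case: FX => [/Find//|->]; rewrite setU0.
exists (B `|` A)%classic; split; last by move=> v; left.
split=> // u; apply: contrapT => uN.
have {}uN (s : seq V) (a : V -> K) : (forall v, v \in s -> (B `|` A)%classic v) ->
    u <> \sum_(v <- s) a v *: v.
  by move=> sBA us; apply: uN; exists s, a.
have uA : ~ A u.
  move=> Au; apply: (uN [:: u] (fun=> 1)); last by rewrite big_seq1 scale1r.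
  by move=> v; rewrite inE => /eqP ->; right.
apply: (maxA (A `|` [set u])%classic).
  by split; [move=> v; left|move=> /(_ u); apply: contra_not uA; apply; right].
by rewrite setUA; exact: lin_indep_add.
Qed.

Lemma dim_ge_family (N : nat) (e : 'I_N -> V) :
  (forall a : 'I_N -> K, \sum_i a i *: e i = 0 -> forall i, a i = 0) ->
  dim_ge V N.
Proof.
move=> inde.
have sum1 i : \sum_k (k == i)%:R *: e k = e i.
  rewrite (bigD1 i) //= eqxx scale1r big1 ?addr0 // => k /negbTE ->.
  by rewrite scale0r.
have e_inj : injective e.
  move=> i j eij; have := inde (fun k => (k == i)%:R - (k == j)%:R).
  under eq_bigr do rewrite scalerBl.
  rewrite sumrB !sum1 eij subrr => /(_ erefl i); rewrite eqxx.
  by have [//|_ /eqP] := eqVneq i j; rewrite /= subr0 oner_eq0.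
have [|C [Cbasis eC]] := @lin_indep_basis (range e).
  move=> s a us se s0 v vs.
  have [i _ eiv] := se v vs; rewrite -eiv.
  have := inde (fun k => if e k \in s then a (e k) else 0).
  suff -> : \sum_k (if e k \in s then a (e k) else 0) *: e k = 0.
    by move=> /(_ erefl i); rewrite eiv vs.
  rewrite -[RHS]s0 (perm_big [seq e k | k <- enum 'I_N & e k \in s]); last first.
    apply: uniq_perm => //; first by rewrite map_inj_uniq // filter_uniq // enum_uniq.
    move=> w; apply/idP/mapP => [ws|[k + ->]]; last by rewrite mem_filter => /andP[].
    by have [k _ ekw] := se w ws; exists k => //; rewrite mem_filter ekw ws mem_enum.
  rewrite big_map big_filter big_enum_cond [RHS]big_mkcond /=; apply: eq_bigr => k _.
  by case: ifP => _; rewrite ?scale0r.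
exists C; split=> //.
by rewrite -(card_le_eql (inj_card_eq (in2W e_inj))); exact: subset_card_le.
Qed.
End BasisExtension.

(** * Lower order terms and adapted monomials *)

(** [D m] stands for the value of the normally ordered monomial [m] on a fixed
    vector of a module on which the variables act without commuting. *)
Section LowerTerms.
Context {K : fieldType} {N : nat} {L : vectType K}.
Variable D : 'X_{1..N} -> L.
Implicit Types (m : 'X_{1..N}) (f g : {mpoly K[N]}).

Definition filt (k : nat) : {vspace L} := (\sum_(m : 'X_{1..N < k}) <[D m]>)%VS.

(** The value on the fixed vector of the component of degree [k]. *)
Definition homval (k : nat) f : L :=
  \sum_(m : 'X_{1..N < k.+1} | mdeg m == k) f@_m *: D m.

(** The value of the component of degree [k] is reached by monomials of degree
    less than [k]: the symbol of [f] kills the fixed vector in the associated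
    graded space. *)
Definition drops_order f : Prop := forall k, homval k f \in filt k.

Lemma mem_filt k m : (mdeg m < k)%N -> D m \in filt k.
Proof. by move=> mk; apply/(subvP (sumv_sup (BMultinom mk) _ _) _ (memv_line _)). Qed.

Lemma filtP k (W : {vspace L}) :
  (forall m, (mdeg m < k)%N -> D m \in W) -> (filt k <= W)%VS.
Proof. by move=> DW; apply/subv_sumP => -[m mk] _; rewrite -memvE DW. Qed.

Lemma filt_sub k k' : (k <= k')%N -> (filt k <= filt k')%VS.
Proof. by move=> kk'; apply: filtP => m mk; rewrite mem_filt // (leq_trans mk). Qed.

Lemma homval_is_linear k : linear (homval k).
Proof.
move=> a f g; rewrite /homval scaler_sumr -big_split /=; apply: eq_bigr => m _.
by rewrite mcoeffD mcoeffZ scalerDl scalerA.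
Qed.
HB.instance Definition _ (k : nat) :=
  GRing.isLinear.Build K {mpoly K[N]} L _ (homval k) (homval_is_linear k).

Lemma homvalX k m : homval k 'X_[m] = (mdeg m == k)%:R *: D m.
Proof.
rewrite /homval; have [mk|mk] := eqVneq (mdeg m) k; last first.
  rewrite scale0r big1 // => m' /eqP m'k; rewrite mcoeffX.
  by case: eqP => [mm'|_]; rewrite ?scale0r //; rewrite mm' m'k eqxx in mk.
have mk1 : (mdeg m < k.+1)%N by rewrite mk.
rewrite (bigD1 (BMultinom mk1)) /= ?mk // mcoeffX eqxx big1 ?addr0 // => m'.
rewrite mcoeffX => /andP[_ m'm]; rewrite (_ : (m == m') = false) ?scale0r //.
apply: contraNF m'm => /eqP mm'; apply/eqP/val_inj; exact/esym.
Qed.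

Lemma drops_orderD f g : drops_order f -> drops_order g -> drops_order (f + g).
Proof. by move=> lf lg k; rewrite linearD; apply: memvD; [exact: lf|exact: lg]. Qed.

Lemma drops_orderZ a f : drops_order f -> drops_order (a *: f).
Proof. by move=> lf k; rewrite linearZ /=; apply: memvZ; exact: lf. Qed.

Lemma drops_order_sum (I : Type) (r : seq I) (P : pred I) (F : I -> {mpoly K[N]}) :
  (forall i, P i -> drops_order (F i)) -> drops_order (\sum_(i <- r | P i) F i).
Proof. by move=> lF k; rewrite linear_sum; apply: memv_suml => i Pi; exact: lF. Qed.

Section Operators.
Variable op : 'I_N -> {linear L -> L}.
(** Left multiplication by a variable commutes with normal ordering, up to terms of
    smaller degree. *)
Hypothesis op_filt :
  forall i m, D (m + U_(i))%MM - op i (D m) \in filt (mdeg m).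

Lemma op_filtS i k F : F \in filt k -> op i F \in filt k.+1.
Proof.
move=> /memv_sumP[vs Fvs ->]; rewrite linear_sum memv_suml // => -[m mk] /= _.
have /vlineP[c ->] := Fvs (BMultinom mk) isT; rewrite linearZ /= memvZ //.
rewrite -[op i _](subKr (D (m + U_(i))%MM)) rpredB ?mem_filt ?mdegD ?mdeg1 ?addn1 //.
apply: subvP (op_filt i m); apply: filt_sub; exact: leq_trans (ltnW mk) _.
Qed.

Lemma drops_order_mulXU i f : drops_order f -> drops_order ('X_i * f).
Proof.
move=> lf [|k].
  rewrite [f]mpolyE mulr_sumr linear_sum memv_suml // => m _.
  by rewrite -scalerAr -mpolyXD linearZ /= homvalX mdegD mdeg1 scale0r scaler0 mem0v.
rewrite -[homval _ _](subrK (op i (homval k f))) rpredD //; last exact: op_filtS.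
apply: subvP (filt_sub (leqnSn k)) _ _.
have -> : homval k.+1 ('X_i * f) =
    \sum_(m <- msupp f) f@_m *: homval k.+1 'X_[U_(i) + m].
  rewrite [in LHS](mpolyE f) mulr_sumr linear_sum; apply: eq_bigr => m _.
  by rewrite -scalerAr -mpolyXD linearZ.
have -> : op i (homval k f) = \sum_(m <- msupp f) f@_m *: op i (homval k 'X_[m]).
  rewrite [in LHS](mpolyE f) (linear_sum (homval k)) (linear_sum (op i)); apply: eq_bigr => m _.
  by rewrite !linearZ.
rewrite -sumrB memv_suml // => m _; rewrite -scalerBr memvZ // !homvalX.
rewrite addmC mdegD mdeg1 addn1 eqSS; case: eqP => [<-|_]; first by rewrite !scale1r.
by rewrite !scale0r linear0 subr0 mem0v.
Qed.

Lemma drops_order_mull g f : drops_order f -> drops_order (g * f).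
Proof.
move=> lf; rewrite [g]mpolyE mulr_suml; apply: drops_order_sum => m _.
rewrite -scalerAl; apply: drops_orderZ; rewrite mpolyXE_id.
elim/big_rec: _ => [|i h _ IH]; first by rewrite mul1r.
rewrite -mulrA; elim: (m i) => [|j IHj]; first by rewrite expr0 mul1r.
by rewrite exprS -mulrA; apply: drops_order_mulXU.
Qed.
End Operators.

(** Greedy choice of monomials, one at a time. *)
Lemma free_extension (X : seq L) (s : seq 'X_{1..N}) : free X ->
  exists t, [/\ {subset t <= s}, free (X ++ map D t) &
                {subset map D s <= <<X ++ map D t>>%VS}].
Proof.
move=> freeX; elim: s => [|m s [t [ts freet st]]].
  by exists [::]; split; rewrite ?cats0.
have [mt|mt] := boolP (D m \in <<X ++ map D t>>%VS).
  exists t; split=> // [m' /ts|v]; first by rewrite inE orbC => ->.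
  by rewrite inE => /predU1P[->//|/st].
have perm_mt : perm_eq (X ++ map D (m :: t)) (D m :: X ++ map D t).
  by rewrite perm_catC /= perm_cons perm_catC.
exists (m :: t); split.
- by move=> m'; rewrite !inE => /predU1P[->|/ts ->]; rewrite ?eqxx ?orbT.
- by rewrite (perm_free perm_mt) free_cons mt.
- move=> v; rewrite (eq_span (perm_mem perm_mt)) span_cons inE => /predU1P[->|/st vt].
    by apply: subvP (addvSl _ _) _ (memv_line _).
  by apply: subvP vt; rewrite addvSr.
Qed.

Lemma free_cat_coef (X : seq L) (s : seq 'X_{1..N}) (a : 'X_{1..N} -> K) :
  free (X ++ map D s) -> \sum_(m <- s) a m *: D m \in <<X>>%VS ->
  {in s, forall m, a m = 0}.
Proof.
elim: s => [//|m s IH]; rewrite big_cons /=.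
rewrite (@perm_free _ _ _ (D m :: X ++ map D s)); last first.
  by rewrite perm_catC /= perm_cons perm_catC.
rewrite free_cons => /andP[Dm freeXs] sumX.
have am : a m = 0.
  apply: contraNeq Dm => am; rewrite -[D m](scalerK am) memvZ //.
  rewrite -[_ *: _](addrK (\sum_(m <- s) a m *: D m)) rpredB //.
    by apply: subvP sumX; rewrite span_cat addvSl.
  rewrite big_seq rpred_sum // => m' m's; rewrite memvZ // memv_span //.
  by rewrite mem_cat map_f ?orbT.
move: sumX; rewrite am scale0r add0r => /(IH freeXs) as0 m'.
by rewrite inE => /predU1P[->|/as0].
Qed.

(** Independence modulo the polynomials that drop in order is checked from the
    top degree downwards: the values of the monomials of degree [k] are chosen
    independent modulo [filt k]. *)
Lemma adapted_monomials k : exists t : seq 'X_{1..N},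
  [/\ uniq t /\ {in t, forall m, (mdeg m < k)%N},
      free (map D t), <<map D t>>%VS = filt k &
      forall a : 'X_{1..N} -> K, drops_order (\sum_(m <- t) a m *: 'X_[m]) ->
        {in t, forall m, a m = 0}].
Proof.
elim: k => [|k [t [[ut tk] freet spant indt]]].
  exists [::]; split=> //; first by rewrite nil_free.
  by rewrite span_nil /filt big_pred0 // => -[].
pose s := [seq bmnm m | m : 'X_{1..N < k.+1} <- enum {: 'X_{1..N < k.+1}} & mdeg m == k].
have [t' [t's freett' st']] := free_extension s freet.
have t'k m : m \in t' -> mdeg m = k.
  by move=> /t's /mapP[m' + ->]; rewrite mem_filter => /andP[/eqP].
exists (t ++ t'); split.
- split; first by apply: (@map_uniq _ _ D); rewrite map_cat free_uniq.
  by move=> m; rewrite mem_cat ltnS => /orP[/tk/ltnW//|/t'k ->].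
- by rewrite map_cat.
- apply/eqP; rewrite eqEsubv; apply/andP; split.
    apply/span_subvP => _ /mapP[m + ->]; rewrite mem_cat => /orP[/tk mk|/t'k mk].
      by rewrite mem_filt // ltnW.
    by rewrite mem_filt ?mk.
  apply: filtP => m; rewrite ltnS leq_eqVlt => /orP[mk|mk]; last first.
    rewrite map_cat span_cat; apply: subvP (addvSl _ _) _ _.
    by rewrite spant mem_filt.
  rewrite map_cat; apply: st'; apply: map_f; apply/mapP.
  have mk1 : (mdeg m < k.+1)%N by rewrite (eqP mk).
  by exists (BMultinom mk1) => //; rewrite mem_filter mk mem_enum.
move=> a la.
have at' : {in t', forall m, a m = 0}.
  have := la k; rewrite big_cat linearD !linear_sum /=.
  rewrite big_seq big1 ?add0r => [|m /tk mk]; last first.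
    by rewrite linearZ /= homvalX (ltn_eqF mk) scale0r scaler0.
  rewrite (_ : \sum_(_ <- t') _ = \sum_(m <- t') a m *: D m); last first.
    rewrite !big_seq; apply: eq_bigr => m /t'k mk.
    by rewrite linearZ /= homvalX mk eqxx scale1r.
  by rewrite -spant; apply: free_cat_coef.
move=> m; rewrite mem_cat => /orP[|/at'//]; apply: indt.
move: la; rewrite big_cat /= [X in _ + X]big_seq [X in _ + X]big1 ?addr0 // => m' mt'.
by rewrite at' // scale0r.
Qed.

Lemma dim_ge_filt_full (V : lmodType K) (p : {linear {mpoly K[N]} -> V}) :
  (forall f, p f = 0 -> drops_order f) -> (exists k, filt k = fullv) ->
  dim_ge V (\dim {:L}).
Proof.
move=> plow [k filtk].
have [t [[ut _] freet spant indt]] := adapted_monomials k.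
have <- : size t = \dim {:L}.
  by rewrite -filtk -spant; move: freet; rewrite /free size_map => /eqP.
apply: (@dim_ge_family _ _ _ (fun i => p 'X_[tnth (in_tuple t) i])) => a a0 i.
have t_inj : injective (tnth (in_tuple t)) by apply/tuple_uniqP.
pose a' (m : 'X_{1..N}) := \sum_(i < size t | tnth (in_tuple t) i == m) a i.
have a'E j : a' (tnth (in_tuple t) j) = a j.
  by rewrite /a' (big_pred1 j) // => j'; rewrite (inj_eq t_inj).
rewrite -a'E; apply: indt (mem_tnth i (in_tuple t)); apply: plow.
rewrite linear_sum -[RHS]a0 -[X in \sum_(_ <- X) _]/(tval (in_tuple t)).
by rewrite big_tuple; apply: eq_bigr => j _; rewrite linearZ /= a'E.
Qed.
End LowerTerms.

(** * The rank one module *)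

Section RankOneWords.
Context {K : fieldType} (d : nat) (c : nat -> K).

(** The coefficient of e_b in Y^s X^t e_a, where X e_a = e_{a+1}, e_d = 0, and
    Y e_a = c(a) e_{a-1}.  The raising steps come first, so a path stays inside the
    basis as soon as its highest point a + t and its end b do. *)
Definition word (s t a b : nat) : K :=
  if (b + s == a + t)%N && (a + t < d)%N then \prod_(k < s) c (a + t - k) else 0.

Lemma word00 a b : (a < d)%N -> word 0 0 a b = (b == a)%:R.
Proof. by move=> ad; rewrite /word !addn0 ad andbT big_ord0; case: eqP. Qed.

(** The matrix entries in row b and column k of Y and X. *)
Definition lower_coef (b k : nat) : K := (k == b.+1)%:R * c k.
Definition raise_coef (b k : nat) : K := (b == k.+1)%:R.

Lemma lower_word s t a b :
  \sum_(k < d) lower_coef b k * word s t a k = word s.+1 t a b.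
Proof.
have [bd|db] := ltnP b.+1 d; last first.
  rewrite big1 => [|k _]; last first.
    by rewrite /lower_coef (ltn_eqF (leq_trans (ltn_ord k) db)) mul0r mul0r.
  rewrite /word; case: ifP => // /andP[/eqP bs]; lia.
rewrite (bigD1 (Ordinal bd)) //= big1 ?addr0 => [|k kb]; last first.
  by rewrite /lower_coef (_ : (k == b.+1 :> nat) = false) ?mul0r //; apply/negbTE.
rewrite /lower_coef eqxx mul1r /word addSnnS; case: ifP => [/andP[/eqP bs _]|_].
  by rewrite big_ord_recr /= mulrC -bs addnS subSn ?leq_addl // addnK.
by rewrite mulr0.
Qed.

Hypotheses (c0 : c 0 = 0) (cd : c d = 0).

(** Moving X to the right through Y^s costs a multiple of Y^(s-1).  The conditions
    c(0) = c(d) = 0 take care of the two ends of the basis. *)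
Lemma raise_word s t a b : (b < d)%N ->
  \sum_(k < d) raise_coef b k * word s t a k =
  word s t.+1 a b + (c (a + t.+1 - s) - c (a + t.+1)) * word s.-1 t a b.
Proof.
move=> bd.
have -> : \sum_(k < d) raise_coef b k * word s t a k =
    if b is k.+1 then word s t a k else 0.
  case: b bd => [|b] bd; rewrite /raise_coef.
    by rewrite big1 // => k _; rewrite mul0r.
  rewrite (bigD1 (Ordinal (ltnW bd))) //= eqxx mul1r big1 ?addr0 // => k kb.
  by rewrite eqSS eq_sym (_ : (k == b :> nat) = false) ?mul0r //; apply/negbTE.
case: s => [|s].
  rewrite subn0 subrr mul0r addr0 /word addn0.
  case: b bd => [|b] bd; first by case: ifP => //; lia.
  rewrite !big_ord0; do 2 case: ifP => //; lia.
rewrite /= /word.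
have -> : (if b is k.+1 then
      if (k + s.+1 == a + t)%N && (a + t < d)%N then \prod_(k < s.+1) c (a + t - k) else 0
      else 0) =
    if (b + s == a + t)%N && (a + t < d)%N then
      c (a + t.+1 - s.+1) * \prod_(k < s) c (a + t - k) else 0.
  case: b bd => [|b] bd; last first.
    rewrite addSnnS big_ord_recr /= mulrC; case: ifP => // /andP[/eqP bs _].
    by congr (_ * _); congr (c _); lia.
  by case: ifP => // /andP[/eqP bs _]; rewrite (_ : _ - _ = 0)%N ?c0 ?mul0r //; lia.
rewrite !addnS eqSS subSS.
have [bs|bs] := eqVneq (b + s)%N (a + t)%N; last by rewrite mulr0 addr0.
have -> : \prod_(k < s.+1) c ((a + t).+1 - k) =
    c (a + t).+1 * \prod_(k < s) c (a + t - k).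
  by rewrite big_ord_recl subn0.
have [atd|dat] := ltnP (a + t) d; last first.
  by rewrite ltnNge leqW //= mulr0 addr0.
have [atd1|dat1] := ltnP (a + t).+1 d; first by rewrite /=; ring.
have -> : (a + t).+1 = d by lia.
by rewrite /= cd; ring.
Qed.

Hypothesis c_neq0 : forall a, (0 < a < d)%N -> c a != 0.

(** Y^s X^t with t = d-1-a0 kills the e_a with a > a0, and for s = d-1-b0 it sends
    e_{a0} to a nonzero multiple of e_{b0}; matrix units are thus obtained by a
    triangular elimination on a0. *)
Lemma words_span_matrix_units (b0 a0 : 'I_d) :
  exists gamma : 'I_d * 'I_d -> K, forall a b : 'I_d,
    \sum_p gamma p * word p.1 p.2 a b = ((b == b0) && (a == a0))%:R.
Proof.
pose wmx (p : 'I_d * 'I_d) : 'M[K]_d := \matrix_(b, a) word p.1 p.2 a b.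
suff : delta_mx b0 a0 \in (\sum_p <[wmx p]>)%VS.
  move=> /memv_sumP[vs wvs dE].
  have /(_ _)/cid g p : exists g, vs p = g *: wmx p by apply/vlineP/wvs.
  exists (fun p => sval (g p)) => a b.
  move/matrixP/(_ b a): dE; rewrite summxE mxE => ->; apply: eq_bigr => p _.
  by case: (g p) => x /= ->; rewrite !mxE.
elim/ltn_ind: {a0}(a0 : nat) {-2}a0 (erefl (a0 : nat)) b0 => k IH a0 a0k b0.
pose s : 'I_d := rev_ord b0; pose t : 'I_d := rev_ord a0.
have wE b a : wmx (s, t) b a =
    if (b + a0 == a + b0)%N && (a <= a0)%N then \prod_(k < s) c (a + t - k) else 0.
  rewrite mxE /word /=; have := ltn_ord a; have := ltn_ord b.
  have := ltn_ord a0; have := ltn_ord b0 => *.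
  congr (if _ && _ then _ else _); first by apply/eqP/eqP; lia.
  by apply/idP/idP; lia.
have w0 : wmx (s, t) b0 a0 != 0.
  rewrite wE addnC eqxx leqnn prodf_seq_neq0; apply/allP => /= i _.
  by apply: c_neq0; have := ltn_ord i; have := ltn_ord a0; have := ltn_ord b0; rewrite /=; lia.
rewrite -[delta_mx b0 a0](scalerK w0) memvZ //.
have -> : wmx (s, t) b0 a0 *: delta_mx b0 a0 = wmx (s, t) -
    \sum_(p | p != (b0, a0)) wmx (s, t) p.1 p.2 *: delta_mx p.1 p.2.
  apply/eqP; rewrite eq_sym subr_eq; apply/eqP.
  by rewrite [LHS]matrix_sum_delta pair_bigA (bigD1 (b0, a0)) //=.
rewrite rpredB //; first by rewrite memvE (sumv_sup (s, t)).
rewrite memv_suml // => -[b a] /=; rewrite xpair_eqE wE => ba.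
case: ifP => [/andP[/eqP bE aa]|_]; last by rewrite scale0r mem0v.
rewrite memvZ // (IH a) // -a0k ltn_neqAle aa andbT.
by apply: contra ba => /eqP aa0; apply/andP; split; apply/eqP/val_inj => /=; lia.
Qed.
End RankOneWords.

(** * Normally ordered monomials acting on the antisymmetric vector *)

Section Determinants.
Context {K : fieldType} {n : nat}.

Lemma det_row_sum (I : finType) (i : 'I_n) (a : I -> K) (M : I -> 'M[K]_n) (B : 'M[K]_n) :
  (forall k i' j, i' != i -> M k i' j = B i' j) ->
  (forall j, B i j = \sum_k a k * M k i j) ->
  \det B = \sum_k a k * \det (M k).
Proof.
move=> MB Bi; under eq_bigr do rewrite (expand_det_row _ i) mulr_sumr.
rewrite exchange_big (expand_det_row _ i); apply: eq_bigr => j _.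
rewrite Bi mulr_suml; apply: eq_bigr => k _; rewrite /cofactor -!mulrA.
congr (_ * (_ * (_ * \det _))).
by apply/matrixP => i' j'; rewrite !mxE MB // eq_sym neq_lift.
Qed.

(** Full multilinear expansion of a determinant along its rows. *)
Lemma det_sum_rows (I : finType) (g : 'I_n -> I -> K) (w : 'I_n -> I -> 'I_n -> K) :
  \det (\matrix_(i, j) \sum_q g i q * w i q j) =
  \sum_(p : {ffun 'I_n -> I}) (\prod_i g i (p i)) * \det (\matrix_(i, j) w i (p i) j).
Proof.
transitivity (\sum_(p : {ffun 'I_n -> I}) \sum_(s : 'S_n)
    (-1) ^+ s * \prod_i (g i (p i) * w i (p i) (s i))).
  rewrite exchange_big; apply: eq_bigr => s _; rewrite -mulr_sumr; congr (_ * _).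
  rewrite -(bigA_distr_bigA (fun i q => g i q * w i q (s i))).
  by apply: eq_bigr => i _; rewrite mxE.
apply: eq_bigr => p _; rewrite /determinant mulr_sumr; apply: eq_bigr => s _.
rewrite big_split /= mulrCA; congr (_ * (_ * _)).
by apply: eq_bigr => i _; rewrite mxE.
Qed.
End Determinants.

Section Slater.
Context {K : fieldType}.
Variables (n d l r0 : nat) (c : nat -> K).

Local Notation config := {ffun 'I_n -> 'I_d}.
Local Notation wavefun := {ffun config -> K^o}.
Local Notation lam j := (r0 + l * j)%N.
Implicit Types (m : 'X_{1..n + n}) (b : config) (F : wavefun).

(** Row [i] holds the coordinates at e_{b_i} of the words Y^alpha_i X^beta_i
    applied to the vectors e_{r0 + l j}; the determinant is then the coordinate at
    e_{b_1} (x) ... (x) e_{b_n} of Y^alpha X^beta applied to the antisymmetrization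
    of these vectors. *)
Definition slater_mx m b : 'M[K]_n := \matrix_(i, j)
  word d c (m (lshift n i)) (m (rshift n i)) (lam j) (b i).

Definition slater m : wavefun := [ffun b : config => \det (slater_mx m b)].

Definition update b (i : 'I_n) (k : 'I_d) : config :=
  [ffun j => if j == i then k else b j].

(** The operator with matrix [A] acting on the tensor factor [i]. *)
Definition slot_op (A : nat -> nat -> K) (i : 'I_n) F : wavefun :=
  [ffun b : config => \sum_(k < d) A (b i) k * F (update b i k)].

Lemma slot_op_is_linear A i : linear (slot_op A i).
Proof.
move=> a F G; apply/ffunP => b; rewrite !ffunE scaler_sumr -big_split /=.
apply: eq_bigr => k _; rewrite !ffunE /GRing.scale /=; ring.
Qed.
HB.instance Definition _ (A : nat -> nat -> K) (i : 'I_n) :=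
  GRing.isLinear.Build K wavefun wavefun _ (slot_op A i) (slot_op_is_linear A i).

Definition var_op (k : 'I_(n + n)) : {linear wavefun -> wavefun} :=
  match split k with
  | inl i => slot_op (lower_coef c) i
  | inr i => slot_op raise_coef i
  end.

Lemma slot_op_slater A i m b :
  slot_op A i (slater m) b = \det (\matrix_(i', j)
    if i' == i then \sum_(k < d) A (b i) k *
       word d c (m (lshift n i)) (m (rshift n i)) (lam j) k
    else slater_mx m b i' j).
Proof.
rewrite (@det_row_sum _ _ _ i (fun k : 'I_d => A (b i) k)
  (fun k => slater_mx m (update b i k))) => [|k i' j i'i|j].
- by rewrite ffunE; apply: eq_bigr => k _; rewrite ffunE.
- by rewrite !mxE !ffunE (negbTE i'i).
- by rewrite !mxE eqxx; apply: eq_bigr => k _; rewrite !mxE !ffunE eqxx.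
Qed.

Hypotheses (l_gt0 : (0 < l)%N) (c0 : c 0 = 0) (cd : c d = 0).

Lemma slater_lower i m :
  slater (m + U_(lshift n i))%MM = slot_op (lower_coef c) i (slater m).
Proof.
apply/ffunP => b; rewrite slot_op_slater ffunE; congr (\det _).
apply/matrixP => i' j; rewrite !mxE !mnmDE !mnm1E.
rewrite eq_lshift eq_lrshift addn0 eq_sym.
case: eqP => [->|_]; first by rewrite lower_word addn1.
by rewrite addn0.
Qed.

Variable tau : K.
Hypothesis c_shift : forall a, c (a + l) = c a + tau.

Lemma c_shiftn a k : c (a + l * k) = c a + tau *+ k.
Proof.
elim: k => [|k IH]; first by rewrite muln0 addn0 addr0.
by rewrite mulnSr addnA c_shift IH mulrSr addrA.
Qed.

(** The scalar by which X Y^s - Y^s X acts as a multiple of Y^(s-1) on X^t e_a, for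
    a = r0 modulo l.  The representative a = r0 + l s is large enough for
    the natural number subtraction to be exact. *)
Definition kappa (s t : nat) : K :=
  c (lam s + t.+1 - s) - c (lam s + t.+1).

(** Since c(a + l) - c(a) is constant, the scalar depends on a modulo l only: it is
    common to all the columns of the Slater matrix, which makes the commutator act
    as a scalar. *)
Lemma kappa_word s t j (b : nat) :
  (c (lam j + t.+1 - s) - c (lam j + t.+1)) * word d c s.-1 t (lam j) b =
  kappa s t * word d c s.-1 t (lam j) b.
Proof.
have [->|w0] := eqVneq (word d c s.-1 t (lam j) b) 0; first by rewrite !mulr0.
congr (_ * _); rewrite /kappa.
have sle : (s <= lam j + t.+1)%N.
  by move: w0; rewrite /word; case: ifP; rewrite ?eqxx // => /andP[/eqP + _] _; lia.
have sle' : (s <= lam s + t.+1)%N by nia.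
have e1 : (lam j + t.+1 + l * s = lam s + t.+1 + l * j)%N by lia.
have e2 : (lam j + t.+1 - s + l * s = lam s + t.+1 - s + l * j)%N by lia.
have /(congr1 c) := e1; have /(congr1 c) := e2; rewrite !c_shiftn => E2 E1.
apply: (addIr (c (lam j + t.+1) + tau *+ s)).
by rewrite [in RHS]E1 !addrA !subrK.
Qed.

Lemma slater_raise i m :
  let s := m (lshift n i) in let t := m (rshift n i) in
  slot_op raise_coef i (slater m) =
  slater (m + U_(rshift n i))%MM + kappa s t *: slater (m - U_(lshift n i))%MM.
Proof.
move=> s t; apply/ffunP => b; rewrite slot_op_slater !ffunE /GRing.scale /=.
rewrite -[X in X + _]mul1r; apply: (@determinant_multilinear _ _ _ _ _ i).
- apply/rowP => j; rewrite !mxE eqxx raise_word // kappa_word !mnmDE !mnmBE !mnm1E.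
  by rewrite !eqxx eq_lrshift eq_rlshift addn0 addn1 subn0 subn1 mul1r.
- apply/matrixP => i' j; rewrite !mxE eq_sym (negbTE (neq_lift _ _)) !mnmDE !mnm1E.
  by rewrite eq_rlshift eq_rshift (negbTE (neq_lift _ _)) !addn0.
- apply/matrixP => i' j; rewrite !mxE eq_sym (negbTE (neq_lift _ _)) !mnmBE !mnm1E.
  by rewrite eq_lrshift eq_lshift (negbTE (neq_lift _ _)) !subn0.
Qed.

Lemma kappa0 t : kappa 0 t = 0.
Proof. by rewrite /kappa subn0 subrr. Qed.

Lemma var_op_filt k m :
  slater (m + U_(k))%MM - var_op k (slater m) \in filt slater (mdeg m).
Proof.
rewrite /var_op; case: split_ordP => i ->; first by rewrite slater_lower subrr mem0v.
rewrite /= slater_raise opprD addrA subrr add0r rpredN.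
have [->|s0] := eqVneq (m (lshift n i)) 0%N; first by rewrite kappa0 scale0r mem0v.
have mU : (U_(lshift n i) <= m)%MM.
  by apply/mnm_lepP => j; rewrite mnm1E; case: eqP => // <-; rewrite lt0n.
by rewrite memvZ // mem_filt // -[in X in (_ < X)%N](submK mU) mdegD mdeg1 addn1.
Qed.

Hypothesis c_neq0 : forall a, (0 < a < d)%N -> c a != 0.
Hypothesis lam_lt : forall j : 'I_n, (lam j < d)%N.

(** Tensor products of matrix units are combinations of normally ordered words, and
    they move the vector to any e_{b_1} (x) ... (x) e_{b_n}. *)
Lemma filt_slater_full : exists k, filt slater k = fullv.
Proof.
exists ((n + n) * d).+1; apply/eqP; rewrite eqEsubv subvf /=.
have basis_mem b0 : [ffun b : config => (b == b0)%:R] \in filt slater ((n + n) * d).+1.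
  have /(_ _)/cid gam i := words_span_matrix_units c_neq0 (b0 i) (Ordinal (lam_lt i)).
  pose mon (p : {ffun 'I_n -> 'I_d * 'I_d}) : 'X_{1..n + n} := [multinom
    match split k with inl i => val (p i).1 | inr i => val (p i).2 end | k < n + n].
  rewrite [X in X \in _](_ : _ = \sum_(p : {ffun 'I_n -> 'I_d * 'I_d})
      (\prod_i sval (gam i) (p i)) *: slater (mon p)).
    rewrite memv_suml // => p _; rewrite memvZ // mem_filt // ltnS mdegE.
    rewrite -[X in (X * d)%N]card_ord -sum_nat_const leq_sum // => k _.
    by rewrite mnmE; case: split => i; apply/ltnW/ltn_ord.
  apply/ffunP => b; rewrite sum_ffunE ffunE.
  under eq_bigr do rewrite ffunE /GRing.scale /= ffunE.
  transitivity (\det (\matrix_(i, j) \sum_q sval (gam i) q *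
      word d c q.1 q.2 (lam (j : 'I_n)) (b i))).
    (* the factor i extracts e_{r0 + l i}, so only the identity permutation survives *)
    rewrite [X in \det X](_ : _ = diag_mx (\row_i (b i == b0 i)%:R)).
      rewrite det_diag; have [->|bb0] := eqVneq b b0.
        by rewrite big1 // => i _; rewrite mxE eqxx.
      have [i bi] : exists i, b i != b0 i.
        apply/existsP; apply: contraNT bb0; rewrite negb_exists => /forallP bb0.
        by apply/eqP/ffunP => i; apply/eqP; rewrite -[_ == _]negbK.
      by rewrite (bigD1 i) //= mxE (negbTE bi) mul0r.
    apply/matrixP => i j; rewrite !mxE; case: (gam i) => g /= /(_ (Ordinal (lam_lt j)) (b i)) ->.
    rewrite -[RHS]mulr_natr -natrM mulnb; congr (_ && _)%:R.
    by rewrite -val_eqE /= eqn_add2l eqn_pmul2l // eq_sym.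
  rewrite det_sum_rows; apply: eq_bigr => p _; congr (_ * \det _).
  by apply/matrixP => i j; rewrite !mxE !mnmE (unsplitK (inl _ i)) (unsplitK (inr _ i)).
apply/subvP => F _; rewrite [F](_ : _ = \sum_b0 F b0 *: [ffun b : config => (b == b0)%:R]).
  by rewrite memv_suml // => b _; rewrite memvZ.
apply/ffunP => b; rewrite sum_ffunE (bigD1 b) //= big1 => [|b' b'b].
  by rewrite !ffunE eqxx addr0 /GRing.scale /= mulr1.
by rewrite !ffunE eq_sym (negbTE b'b) scaler0.
Qed.
End Slater.

(** * Invariants act on the antisymmetric vector by scalars *)

Lemma ground_lt (n l q : nat) (j : 'I_n) : (0 < q)%N ->
  (q.-1 + l * j < l * (n - 1) + 2 * q - 1)%N.
Proof. by have := ltn_ord j; nia. Qed.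

(** The numerical heart of the bound: residues r modulo l with r = -1 modulo q are
    q-1, 2q-1, ..., and only for r = q-1 does the interval [0, d) contain n numbers
    of residue r. *)
Lemma exponents_perm (n l q : nat) (b : 'I_n -> nat) :
  (0 < l)%N -> (0 < q)%N -> (q %| l)%N -> injective b ->
  (forall i, b i < l * (n - 1) + 2 * q - 1)%N ->
  (forall i j, b i = b j %[mod l]) ->
  (forall i, b i = q.-1 %[mod q]) ->
  exists s : 'S_n, forall i, b i = (q.-1 + l * s i)%N.
Proof.
move=> l0 q0 ql binj bd bl bq.
have [n0|[i0 _]] : (forall i : 'I_n, False) \/ (exists i : 'I_n, true).
  case: (posnP n) => [n0|n0]; last by right; exists (Ordinal n0).
  by left; rewrite n0 => -[].
- by exists 1%g; move=> i; case: (n0 i).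
pose r := (b i0 %% l)%N.
have bE i : b i = (b i %/ l * l + r)%N by rewrite {1}(divn_eq (b i) l) /r (bl i i0).
have quo_inj : injective (fun i => b i %/ l)%N.
  by move=> i j /= e; apply: binj; rewrite bE (bE j) e.
have /eqP rq : r == q.-1 %[mod q] by rewrite /r modn_dvdm // (bq i0).
have rE : r = (r %/ q * q + q.-1)%N.
  by rewrite {1}(divn_eq r q) rq (modn_small (_ : q.-1 < q)%N) ?prednK.
have [e0|e0] := posnP (r %/ q); last first.
  (* a larger residue would leave only n - 1 possible exponents below the bound *)
  have n1 i : (b i %/ l < n.-1)%N.
    have := bd i; have := bE i; have := ltn_ord i0; nia.
  pose f i := Ordinal (n1 i).
  have f_inj : injective f by move=> i j /(congr1 val) /= /quo_inj.
  by have := leq_card f f_inj; rewrite !card_ord; have := ltn_ord i0; lia.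
have q_le_l := dvdn_leq l0 ql.
have quo_lt i : (b i %/ l < n)%N.
  have := bd i; have := bE i; have := ltn_ord i0; nia.
pose f i := Ordinal (quo_lt i).
have f_inj : injective f by move=> i j /(congr1 val) /= /quo_inj.
exists (perm f_inj); move=> i; by rewrite permE /= [LHS]bE rE e0; lia.
Qed.

Section BlockPermutation.
Variable n : nat.

Definition block_fun (s : 'S_n) (k : 'I_(n + n)) : 'I_(n + n) :=
  match split k with inl i => lshift n (s i) | inr i => rshift n (s i) end.

Lemma block_fun_inj s : injective (block_fun s).
Proof.
move=> j k; rewrite /block_fun.
case: (split_ordP j) => a ->; case: (split_ordP k) => b -> /eqP.
- by rewrite eq_lshift => /eqP /perm_inj ->.
- by rewrite eq_lrshift.
- by rewrite eq_rlshift.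
- by rewrite eq_rshift => /eqP /perm_inj ->.
Qed.

Definition block_perm s : 'S_(n + n) := perm (@block_fun_inj s).

Lemma block_perm_lshift s i : block_perm s (lshift n i) = lshift n (s i).
Proof. by rewrite permE /block_fun (unsplitK (inl _ i)). Qed.

Lemma block_perm_rshift s i : block_perm s (rshift n i) = rshift n (s i).
Proof. by rewrite permE /block_fun (unsplitK (inr _ i)). Qed.

Definition mblock (m : 'X_{1..n + n}) s : 'X_{1..n + n} :=
  [multinom m (block_perm s k) | k < n + n].

End BlockPermutation.

Section Invariants.
Context {K : fieldType}.
Hypothesis two_neq0 : 2 != 0 :> K.
Variables (n l q : nat).
Hypotheses (l_gt0 : (0 < l)%N) (q_gt0 : (0 < q)%N) (q_dvd_l : (q %| l)%N).
Let d := (l * (n - 1) + 2 * q - 1)%N.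
Variable c : nat -> K.

Local Notation config := {ffun 'I_n -> 'I_d}.
Local Notation wavefun := {ffun config -> K^o}.
Local Notation psi := (@slater K n d l q.-1 c).
Implicit Types (m : 'X_{1..n + n}) (b : config) (F : wavefun).

Definition permute b (s : 'S_n) : config := [ffun i => b (s i)].

Definition ground : config := [ffun j => Ordinal (ground_lt l j q_gt0)].

(** These conditions cut out the line of the ground state. *)
Definition ground_antisymmetric F : Prop :=
  (forall b s, F (permute b s) = (-1) ^+ s * F b) /\
  (forall b, F b != 0 -> exists s, b = permute ground s).

Lemma ground_antisymmetric_eq F G : ground_antisymmetric F -> ground_antisymmetric G ->
  G ground = 1 -> F = F ground *: G.
Proof.
move=> [Fs F0] [Gs G0] G1; apply/ffunP => b; rewrite ffunE /GRing.scale /=.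
have [[s ->]|nob] := pselect (exists s, b = permute ground s).
  by rewrite Fs Gs G1 mulr1 mulrC.
have -> : F b = 0 by apply: contra_notP nob => /eqP/F0.
have -> : G b = 0 by apply: contra_notP nob => /eqP/G0.
by rewrite mulr0.
Qed.

Lemma wavefun_scaleE (a : K) F b : (a *: F) b = a * F b.
Proof. by rewrite ffunE. Qed.

Lemma slater_mblock m s b : psi (mblock m s) (permute b s) = (-1) ^+ s * psi m b.
Proof.
rewrite !ffunE -det_perm -det_mulmx -row_permE; congr (\det _).
by apply/matrixP => i j; rewrite !mxE !mnmE block_perm_lshift block_perm_rshift ffunE.
Qed.

(** What invariance under G(l,m,n) says about coefficients: symmetry under
    simultaneous permutations of both sets of variables, and the weight conditions
    imposed by the diagonal matrices. *)
Definition Glmn_support (h : {mpoly K[n + n]}) : Prop :=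
  (forall m s, h@_(mblock m s) = h@_m) /\
  (forall m, h@_m != 0 ->
    (forall i j, m (lshift n i) + m (rshift n j) =
                 m (lshift n j) + m (rshift n i) %[mod l]) /\
    (forall i, m (lshift n i) = m (rshift n i) %[mod q])).

Lemma homval_permute h k b s : Glmn_support h ->
  homval psi k h (permute b s) = (-1) ^+ s * homval psi k h b.
Proof.
move=> [hs _].
have mdeg_mblock m : mdeg (mblock m s) = mdeg m by exact: mdeg_mperm.
have mblock_lt (m : 'X_{1..(n + n) < k.+1}) : (mdeg (mblock m s) < k.+1)%N.
  by rewrite mdeg_mblock bmdeg.
pose f (m : 'X_{1..(n + n) < k.+1}) := BMultinom (mblock_lt m).
have f_inj : injective f.
  by move=> m m' /(congr1 (@bmnm _ _)) /= /mperm_inj /val_inj.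
rewrite /homval !sum_ffunE (reindex_inj f_inj) mulr_sumr.
apply: eq_big => [m|m _]; first by rewrite /= mdeg_mblock.
by rewrite !wavefun_scaleE /= hs slater_mblock mulrCA.
Qed.

(** A word Y^alpha_i X^beta_i shifts exponents by beta_i - alpha_i, and antisymmetry
    makes the exponents distinct; the counting of exponents then applies. *)
Lemma homval_support h k b : Glmn_support h -> homval psi k h b != 0 ->
  exists s, b = permute ground s.
Proof.
move=> hsupp Fb; have [_ hm] := hsupp.
have b_inj : injective (fun i => b i : nat).
  move=> i j /val_inj bij; apply: contraNeq Fb => ij.
  have bt : permute b (tperm i j) = b.
    by apply/ffunP => k'; rewrite ffunE; case: tpermP => // ->.
  have := homval_permute k b (tperm i j) hsupp.
  rewrite bt odd_tperm ij expr1 mulN1r => /eqP; rewrite -addr_eq0 -mulr2n -mulr_natl.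
  by rewrite mulf_eq0 (negbTE two_neq0).
have [m hm0 [s bs]] : exists2 m, h@_m != 0 & exists s : 'S_n, forall i,
    (b i + m (lshift n i) = q.-1 + l * s i + m (rshift n i))%N.
  apply: contrapT => nom; case/negP: Fb; rewrite /homval sum_ffunE big1 // => m _.
  rewrite wavefun_scaleE; have [->|hm0] := eqVneq h@_m 0; first by rewrite mul0r.
  rewrite ffunE /determinant big1 ?mulr0 // => s _.
  apply/eqP; rewrite mulf_eq0; apply/orP; right; apply: contra_notT nom.
  move/prodf_neq0 => w; exists m => //; exists s => i; move: (w i isT).
  by rewrite mxE /word; case: ifP; rewrite ?eqxx // => /andP[/eqP].
have [ml mq] := hm m hm0.
have [i j||s' bE] := exponents_perm l_gt0 q_gt0 q_dvd_l b_inj (fun i => ltn_ord (b i)).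
- pose e := (q.-1 + m (rshift n i) + m (rshift n j))%N.
  apply/eqP; rewrite -(eqn_modDr (m (lshift n i) + m (rshift n j))).
  rewrite -[X in _ == X]modnDmr (ml i j) modnDmr.
  have -> : (b i + (m (lshift n i) + m (rshift n j)) = s i * l + e)%N.
    by rewrite /e; have := bs i; lia.
  have -> : (b j + (m (lshift n j) + m (rshift n i)) = s j * l + e)%N.
    by rewrite /e; have := bs j; lia.
  by rewrite !modnMDl.
- move=> i; apply/eqP; rewrite -(eqn_modDr (m (lshift n i))) bs.
  rewrite -[X in _ == X]modnDmr (mq i) modnDmr.
  have -> : (q.-1 + l * s i + m (rshift n i) =
      l %/ q * s i * q + (q.-1 + m (rshift n i)))%N.
    by rewrite mulnAC divnK //; lia.
  by rewrite modnMDl.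
by exists s'; apply/ffunP => i; apply/val_inj; rewrite !ffunE /= bE.
Qed.

Lemma slater0_ground : psi 0%MM ground = 1.
Proof.
rewrite ffunE -[RHS](det1 _ n); congr (\det _); apply/matrixP => i j.
rewrite !mxE !mnm0E word00 ?(ground_lt l j q_gt0) // ffunE /=.
by rewrite eqn_add2l eqn_pmul2l.
Qed.

Lemma homval0_1 : homval psi 0 1 = psi 0%MM.
Proof. by rewrite -mpolyX0 homvalX mdeg0 eqxx scale1r. Qed.

Lemma Glmn_support1 : Glmn_support 1.
Proof.
split=> [m s|m]; rewrite !mcoeff1.
  have -> : (mblock m s == 0%MM) = (m == 0%MM) by rewrite -!mdeg_eq0 mdeg_mperm.
  by [].
by have [->|] := eqVneq m 0%MM; rewrite ?eqxx // => _; split=> *; rewrite !mnm0E.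
Qed.

(** Every homogeneous component acts by a scalar, hence its value lies in the lowest
    step of the filtration, which is a drop as soon as the degree is positive. *)
Lemma drops_order_Glmn_support h : Glmn_support h -> h@_0 = 0 -> drops_order psi h.
Proof.
move=> hsupp h0 [|k].
  rewrite /homval big1 ?mem0v // => m; rewrite mdeg_eq0 => /eqP ->.
  by rewrite h0 scale0r.
have ground_mult k' g : Glmn_support g -> ground_antisymmetric (homval psi k' g).
  by move=> gsupp; split=> [b s|b]; [exact: homval_permute|exact: homval_support].
rewrite (ground_antisymmetric_eq (ground_mult _ _ hsupp) (ground_mult 0 _ Glmn_support1)).
  by rewrite homval0_1 memvZ // mem_filt // mdeg0.
by rewrite homval0_1 slater0_ground.
Qed.
End Invariants.

(** * Invariants of G(l,m,n) *)

Section MonomialGroup.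
Variables (R : realType) (n : nat).
Local Notation C := R[i].

Lemma prim_root_exists (l : nat) : (0 < l)%N -> exists z : C, l.-primitive_root z.
Proof.
move=> l0; have [r rE] := closed_field_poly_normal ('X^l - 1 : {poly C}).
have {}rE : 'X^l - 1 = \prod_(z <- r) ('X - z%:P).
  by rewrite rE (monicP (monicXnsubC _ l0)) scale1r.
have r_unity : all l.-unity_root r.
  by apply/allP => z zr; rewrite /root_of_unity rE root_prod_XsubC.
have r_uniq : uniq r.
  by rewrite -separable_prod_XsubC -rE separable_Xn_sub_1 // pnatr_eq0 -lt0n.
have l_le : (l <= size r)%N.
  by rewrite -ltnS -(size_prod_XsubC r id) -rE size_XnsubC.
by have /hasP[z] := has_prim_root l0 r_unity r_uniq l_le; exists z.
Qed.

Lemma mem_Glmn (l m : nat) (z : 'I_n -> C) (s : 'S_n) :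
  (forall i, z i != 0) -> (forall i, z i ^+ l = 1) -> (\prod_i z i) ^+ (l %/ m) = 1 ->
  (\matrix_(i, j) (z i *+ (s i == j))) \in Glmn n l m.
Proof.
move=> z0 zl zp; rewrite inE; set A := \matrix_(i, j) _.
have A0 i j : (A i j != 0) = (s i == j).
  by rewrite mxE mulrb; case: (s i == j); rewrite ?z0 ?eqxx.
apply/and4P; split.
- apply/forallP => i; apply/forallP => j; rewrite mxE mulrb.
  by case: (s i == j); rewrite ?zl ?eqxx ?orbT.
- apply/forallP => i; rewrite -(card1 (s i)); apply/eqP/eq_card => j.
  by rewrite !inE A0 eq_sym.
- apply/forallP => j; rewrite -(card1 (s^-1 j)%g); apply/eqP/eq_card => i.
  by rewrite !inE A0 -(inj_eq (@perm_inj _ s) i) permKV.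
- rewrite -(pair_big_dep xpredT (fun i j => A i j != 0) (fun i j => A i j)) /=.
  rewrite -[X in _ == X]zp; apply/eqP; congr (_ ^+ _); apply: eq_bigr => i _.
  by rewrite (big_pred1 (s i)) => [|j]; [rewrite mxE eqxx|rewrite /= A0 eq_sym].
Qed.

Lemma invmx_eq (A B : 'M[C]_n) : A *m B = 1%:M -> invmx A = B.
Proof.
move=> AB; have [uA _] := mulmx1_unit AB.
by rewrite -[RHS](mulKmx uA) AB mulmx1.
Qed.

Lemma diag_act_perm (s : 'S_n) f :
  diag_act (perm_mx s : 'M[C]_n) f = msym (block_perm s^-1)%g f.
Proof.
rewrite /diag_act /comp_mpoly /msym; congr (mmap _ _ f); apply/funext => k.
rewrite tnth_mktuple (invmx_eq (_ : _ *m perm_mx s^-1 = _)); last first.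
  by rewrite -perm_mxM mulgV perm_mx1.
case: split_ordP => i ->.
  rewrite block_perm_lshift (bigD1 (s^-1 i)%g) //= !mxE permKV eqxx scale1r.
  rewrite big1 ?addr0 // => j ji; rewrite !mxE -(inj_eq (@perm_inj _ s^-1%g)) permK.
  by rewrite (negbTE ji) scale0r.
rewrite block_perm_rshift (bigD1 (s^-1 i)%g) //= !mxE eqxx scale1r.
by rewrite big1 ?addr0 // => j ji; rewrite !mxE eq_sym (negbTE ji) scale0r.
Qed.

(** Diagonal matrices act on monomials by characters, contragredient on the two
    sets of variables. *)
Lemma diag_act_diag (z : 'I_n -> C) f (m : 'X_{1..n + n}) : (forall i, z i != 0) ->
  (diag_act (diag_mx (\row_i z i)) f)@_m =
  f@_m * \prod_i (z i ^+ m (lshift n i) / z i ^+ m (rshift n i)).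
Proof.
move=> z0; rewrite /diag_act comp_mpolyEX.
have VE : diag_mx (\row_i z i) *m diag_mx (\row_i (z i)^-1) = 1%:M.
  rewrite mulmx_diag; apply/matrixP => i j; by rewrite !mxE divff.
rewrite (invmx_eq VE).
pose w (k : 'I_(n + n)) := match split k with inl i => z i | inr i => (z i)^-1 end.
transitivity ((\sum_(m' <- msupp f) (f@_m' * \prod_k w k ^+ m' k) *: 'X_[m'])@_m).
  congr (_@_m); apply: eq_bigr => m' _; rewrite -scalerA; congr (_ *: _).
  rewrite comp_mpolyX mpolyXE_id -scaler_prod; apply: eq_bigr => k _.
  rewrite tnth_mktuple -exprZn /w; congr (_ ^+ _); case: split_ordP => i ->.
    rewrite (bigD1 i) //= big1 => [|j ji]; rewrite !mxE ?eqxx ?addr0 //.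
    by rewrite (negbTE ji) scale0r.
  rewrite (bigD1 i) //= big1 => [|j ji]; rewrite !mxE ?eqxx ?addr0 //.
  by rewrite eq_sym (negbTE ji) scale0r.
rewrite raddf_sum /=; transitivity (f@_m * \prod_k w k ^+ m k); last first.
  rewrite big_split_ord /= -big_split /=; congr (_ * _); apply: eq_bigr => i _.
  by rewrite /w (unsplitK (inl _ i)) (unsplitK (inr _ i)) exprVn.
under eq_bigr do rewrite mcoeffZ mcoeffX.
have [msf|msf] := boolP (m \in msupp f).
  rewrite (bigD1_seq m) //= eqxx mulr1 [X in _ + X]big1 ?addr0 // => m' /negbTE ->.
  by rewrite mulr0.
rewrite (memN_msupp_eq0 msf) mul0r big_seq big1 // => m' m'f.
case: eqP => [mm'|_]; last by rewrite mulr0.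
by rewrite -mm' m'f in msf.
Qed.

(** The weight conditions come from diag(zeta, zeta^-1) in two positions and from
    zeta^m in one position, for zeta a primitive l-th root of unity. *)
Lemma Glmn_invariant_support (l m : nat) f : (0 < l)%N -> (0 < m)%N -> (m %| l)%N ->
  diag_invariant (Glmn n l m : {pred 'M[C]_n}) f -> Glmn_support l (l %/ m) f.
Proof.
move=> l0 m0 ml finv.
have perm_in (s : 'S_n) : (perm_mx s : 'M[C]_n) \in Glmn n l m.
  have := @mem_Glmn l m (fun=> 1) s.
  rewrite (_ : \matrix_(i, j) _ = perm_mx s).
    by apply=> [i|i|]; rewrite ?oner_eq0 ?big1 ?expr1n.
  by apply/matrixP => i j; rewrite !mxE.
have diag_in (z : 'I_n -> C) : (forall i, z i != 0) -> (forall i, z i ^+ l = 1) ->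
    (\prod_i z i) ^+ (l %/ m) = 1 -> diag_mx (\row_i z i) \in Glmn n l m.
  move=> z0 zl zp; have := @mem_Glmn l m z 1%g z0 zl zp.
  rewrite (_ : \matrix_(i, j) _ = diag_mx (\row_i z i)) //.
  by apply/matrixP => i j; rewrite !mxE perm1.
have [zeta zP] := prim_root_exists l0.
have zeta0 : zeta != 0 by rewrite (prim_root_eq0 zP) -lt0n.
split=> [mu s|mu fmu].
  by rewrite -[in RHS](finv _ (perm_in s^-1%g)) diag_act_perm invgK mcoeff_sym.
have prod1 (z : 'I_n -> C) : (forall i, z i != 0) -> (forall i, z i ^+ l = 1) ->
    (\prod_i z i) ^+ (l %/ m) = 1 ->
    \prod_i (z i ^+ mu (lshift n i) / z i ^+ mu (rshift n i)) = 1.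
  move=> z0 zl zp; apply: (mulfI fmu); rewrite mulr1 -diag_act_diag //.
  by rewrite finv ?diag_in.
split=> [i j|i].
  have [->//|ij] := eqVneq i j.
  pose z k := if k == i then zeta else if k == j then zeta^-1 else 1.
  have prodz (F : 'I_n -> C -> C) : (forall k, F k 1 = 1) ->
      \prod_k F k (z k) = F i zeta * F j zeta^-1.
    move=> F1; rewrite (bigD1 i) //= (bigD1 j) /= 1?eq_sym // big1 => [|k].
      by rewrite /z eqxx eq_sym (negbTE ij) eqxx mulr1.
    by rewrite /z => /andP[/negbTE -> /negbTE ->].
  have := prod1 z; rewrite (prodz (fun k x => x ^+ mu (lshift n k) / x ^+ mu (rshift n k))).
    rewrite (prodz (fun k x => x)) // divff // expr1n => H.
    have {H} : zeta ^+ mu (lshift n i) / zeta ^+ mu (rshift n i) *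
      (zeta^-1 ^+ mu (lshift n j) / zeta^-1 ^+ mu (rshift n j)) = 1.
      apply: H => // k; rewrite /z; (case: ifP => _; last case: ifP => _);
        by rewrite ?invr_eq0 ?oner_eq0 ?exprVn ?(prim_expr_order zP) ?invr1 ?expr1n.
    move=> H; apply/eqP; rewrite -(eq_prim_root_expr zP) !exprD; apply/eqP.
    move: H; rewrite !exprVn invrK => H.
    have zn0 k : zeta ^+ k != 0 by rewrite expf_neq0.
    move: H (zn0 (mu (rshift n i))) (zn0 (mu (lshift n j))).
    move: (zeta ^+ mu (lshift n i)) (zeta ^+ mu (rshift n i)) => x y.
    move: (zeta ^+ mu (lshift n j)) (zeta ^+ mu (rshift n j)) => u v H y0 u0.
    have -> : x * v = x / y * (u^-1 * v) * (u * y) by field; rewrite y0 u0.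
    by rewrite H mul1r.
  by move=> k; rewrite !expr1n divr1.
pose z k := if k == i then zeta ^+ m else 1.
have prodz (F : 'I_n -> C -> C) : (forall k, F k 1 = 1) ->
    \prod_k F k (z k) = F i (zeta ^+ m).
  move=> F1; rewrite (bigD1 i) //= big1 => [|k]; first by rewrite /z eqxx mulr1.
  by rewrite /z => /negbTE ->.
have := prod1 z; rewrite (prodz (fun k x => x ^+ mu (lshift n k) / x ^+ mu (rshift n k))).
  rewrite (prodz (fun k x => x)) // -exprM mulnC divnK // (prim_expr_order zP) => H.
  have {H} : (zeta ^+ m) ^+ mu (lshift n i) / (zeta ^+ m) ^+ mu (rshift n i) = 1.
    apply: H => // k; rewrite /z; case: ifP => _;
      by rewrite ?oner_eq0 ?expf_neq0 // ?expr1n // exprAC (prim_expr_order zP) expr1n.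
  move=> /divr1_eq /eqP; rewrite -!exprM (eq_prim_root_expr zP).
  have lE : l = (m * (l %/ m))%N by rewrite mulnC divnK.
  by rewrite {1 2}lE -!muln_modr eqn_pmul2l // => /eqP.
by move=> k; rewrite !expr1n divr1.
Qed.
End MonomialGroup.

(** * The lower bound *)

(** The correction by d on the class of d modulo l makes c vanish at d while
    keeping c(a + l) - c(a) constant.  It would spoil c(0) = 0 if l divided d. *)
Lemma exists_structure_constants (K : numFieldType) (l d : nat) :
  (0 < l)%N -> (0 < d)%N -> ((d %% l)%N != 0%N) || (d == 1%N) ->
  exists c : nat -> K, exists tau : K,
    [/\ c 0%N = 0, c d = 0, forall a, c (a + l)%N = c a + tau &
        forall a, (0 < a < d)%N -> c a != 0].
Proof.
move=> l0 d0 /orP[dl|/eqP ->]; last first.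
  by exists (fun=> 0); exists 0; split=> // [a|[|a]] //; rewrite addr0.
exists (fun a => a%:R - (if a == d %[mod l] then d%:R else 0)); exists l%:R.
split.
- by rewrite mod0n eq_sym (negbTE dl) subr0.
- by rewrite eqxx subrr.
- by move=> a; rewrite modnDr natrD addrAC.
- move=> a /andP[a0 ad]; case: ifP => _; last by rewrite subr0 pnatr_eq0 -lt0n.
  by rewrite subr_eq0 eqr_nat (ltn_eqF ad).
Qed.

Section CoinvariantProjection.
Variables (R : realType) (n : nat) (W : {pred 'M[R[i]]_n}).
Local Notation polyfun := {mpoly R[i][n + n]}.
Local Open Scope quotient_scope.

Definition coinv_proj (f : polyfun) : diag_coinv W := \pi_(diag_coinv W) f.

Lemma coinv_proj_is_linear : linear coinv_proj.
Proof.
move=> a f g; rewrite /coinv_proj [LHS]rmorphD; congr (_ + _).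
exact: coinv_scaleE.
Qed.
HB.instance Definition _ := GRing.isLinear.Build R[i] polyfun (diag_coinv W) _
  coinv_proj coinv_proj_is_linear.

Lemma coinv_proj_eq0 f : coinv_proj f = 0 -> f \in coinv_ideal W.
Proof.
move=> f0; rewrite -[f]subr0 Quotient.idealrBE; apply/eqP.
by rewrite rmorph0.
Qed.

End CoinvariantProjection.

(** Permutation matrices fix the vector with all coordinates 1. *)
Lemma G1mn_reducible (R : realType) (m n : nat) : (1 < n)%N ->
  ~ irreducible_on (Glmn n 1 m : {pred 'M[R[i]]_n}).
Proof.
move=> n1 [_ irr]; pose u : 'cV[R[i]]_n := const_mx 1.
have i0 : 'I_n := Ordinal (ltnW n1).
have u0 : u != 0.
  by apply/eqP => /matrixP/(_ i0 0)/eqP; rewrite !mxE oner_eq0.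
have [w v|/eqP|/(congr1 (fun U => \dim U))] := irr <[u]>%VS.
- move=> wG /vlineP[a ->]; rewrite -scalemxAr memvZ // (_ : w *m u = u) ?memv_line //.
  move: wG; rewrite inE => /and4P[/forallP w01 /forallP row1 _ _].
  apply/matrixP => i j; rewrite !mxE (bigID [pred k | w i k == 0]) /= big1 ?add0r.
    rewrite (eq_bigr (fun=> 1)) => [|k wik]; first by rewrite sumr_const (eqP (row1 i)).
    have /forallP/(_ k) := w01 i.
    by rewrite (negbTE wik) expr1 => /eqP ->; rewrite mxE mulr1.
  by move=> k /eqP ->; rewrite mul0r.
- by rewrite -dimv_eq0 dim_vline u0.
- by rewrite dim_vline u0 dimvf /dim /=; lia.
Qed.

Theorem theorem1p4 (R : realType) (l m n : nat)
    (l_gt0 : (0 < l)%N) (m_gt0 : (0 < m)%N) (n_gt0 : (0 < n)%N)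
    (m_dvd_l : (m %| l)%N)
    (W_irr : irreducible_on (Glmn n l m : {pred 'M[R[i]]_n})) :
  dim_ge (diag_coinv (Glmn n l m : {pred 'M[R[i]]_n}))
    ((l * (n - 1) + 2 * (l %/ m) - 1) ^ n)%N.
Proof.
set q := (l %/ m)%N; set d := (_ - 1)%N.
have q_gt0 : (0 < q)%N by rewrite divn_gt0 // dvdn_leq.
have q_dvd_l : (q %| l)%N by rewrite /q; apply/dvdnP; exists m; rewrite mulnC divnK.
have d_gt0 : (0 < d)%N by rewrite /d; lia.
have d_cond : ((d %% l)%N != 0%N) || (d == 1%N).
  case: (ltnP 1 l) => [l_gt1|l_le1].
    (* d = 2q - 1 modulo l, and l | 2q - 1 would force q = 1 and l = 1 *)
    apply/orP; left; apply/negP => l_dvd_d.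
    have l_dvd : (l %| 2 * q - 1)%N.
      have : (l %| d)%N by [].
      by rewrite /d -addnBA ?muln_gt0 ?q_gt0 // dvdn_addr // dvdn_mulr.
    have q1 : (q %| 1)%N.
      have : (q %| 2 * q - 1 + 1)%N by rewrite subnK ?muln_gt0 ?q_gt0 // dvdn_mull.
      by rewrite dvdn_addr // (dvdn_trans q_dvd_l).
    move: l_dvd; rewrite (eqP (_ : q == 1%N)) -?dvdn1 // => /dvdn_leq -/(_ isT).
    by rewrite leqNgt l_gt1.
  have l1 : l = 1%N by lia.
  have [n_gt1|n_le1] := ltnP 1 n.
    by move: W_irr; rewrite l1 => /(G1mn_reducible n_gt1).
  apply/orP; right; rewrite /d l1; have := dvdn_leq l_gt0 q_dvd_l.
  have -> : n = 1%N by lia.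
  by rewrite l1 => *; apply/eqP; lia.
have [c [tau [c0 cd c_shift c_neq0]]] := @exists_structure_constants R[i] l d l_gt0 d_gt0 d_cond.
pose psi := @slater R[i] n d l q.-1 c.
have -> : (d ^ n)%N = \dim (fullv : {vspace {ffun {ffun 'I_n -> 'I_d} -> R[i]^o}}).
  by rewrite dimvf /dim /= muln1 card_ffun !card_ord.
apply: (@dim_ge_filt_full _ _ _ psi _ (coinv_proj (Glmn n l m))).
  move=> f /coinv_proj_eq0 /asboolP[s [sG ->]].
  rewrite big_seq; apply: drops_order_sum => g /sG [ginv [e e0 ge]].
  apply: (@drops_order_mull _ _ _ psi (var_op d c)) => [k mu|].
    exact: var_op_filt.
  apply: drops_order_Glmn_support => //; first by rewrite pnatr_eq0.
    exact: Glmn_invariant_support.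
  apply/eqP; rewrite mcoeff_eq0; apply: contraL e0 => zero_g.
  by move/dhomogP: ge => /(_ _ zero_g) /= <-; rewrite mdeg0.
apply: (@filt_slater_full _ n d l q.-1 c) => // j.
exact: ground_lt.
Qed.
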